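(* Let $\Gamma\subset H$ be a regular convex set: there exists a convex $C^\infty$ function $g:H\to\mathbb{R}$ with $g(0)=0$, $g'(0)=0$ and $\langle D^2g(x)h,h\rangle\ge\gamma|h|^2$ for all $x,h\in H$ and some $\gamma>0$, such that $\Gamma=\{g\le1\}$, $\partial\Gamma=\{g=1\}$, $D^2g$ is bounded on $\Gamma$, and $|Q^{1/2}Dg|^{-1}\in\bigcap_{p>1}L^p(H,\mu)$. Then the stochastic differential inclusion $$dX(t)+\bigl(AX(t)+N_\Gamma(X(t))\bigr)\,dt\ni dW(t),\qquad X(0)=x,$$ admits at most one solution; that is, if $(u,L^1)$ and $(v,L^2)$ are two solutions on $[0,T]$ on the same filtered probability space, with the same cylindrical Wiener process $W$ and the same initial value $x$, then $P$-a.s. $u(t)=v(t)$ and $L^1(t)=L^2(t)$ for all $t\in[0,T]$.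
   Context: $H$ is a real separable Hilbert space with inner product $\langle\cdot,\cdot\rangle$ and norm $|\cdot|$. $A:D(A)\subset H\to H$ is a linear self-adjoint operator such that $\langle Ax,x\rangle\ge\delta|x|^2$ for all $x\in D(A)$ and some $\delta>0$, and $A^{-1}$ is of trace class. $\mu$ is the Gaussian measure on $H$ with mean $0$ and covariance $Q=\frac12A^{-1}$. $W$ is a cylindrical Wiener process in $H$ on a filtered probability space $(\Omega,\mathcal{F},\mathcal{F}_t,P)$. $\mathbf{n}_\Gamma=\frac{Dg}{|Dg|}$ is the exterior normal to $\Gamma$ on $\partial\Gamma$, and $N_\Gamma(x)=\{z\in H:\langle z,y-x\rangle\le0\ \forall y\in\Gamma\}$ is the normal cone to $\Gamma$ at $x$. Solution: a pair of continuous, $\mathcal{F}_t$-adapted, $H\times\mathbb{R}$-valued processes $(X(t),L(t))$, $t\in[0,T]$, is a solution if (i) $X(t)\in\Gamma$ for all $t\in[0,T]$ $P$-a.s.; (ii) $L$ is an increasing process (nondecreasing with $L(0)=0$) with $I_{\partial\Gamma}(X_s)\,dL_s=dL_s$ $P$-a.s., and for every $l\in D(A)$ $$\langle l,X_t-x\rangle=\int_0^t\langle l,dW_s\rangle-\int_0^t\langle l,\mathbf{n}_\Gamma(X_s)\rangle\,dL_s-\int_0^t\langle Al,X_s\rangle\,ds\quad\forall t\in[0,T]\ P\text{-a.s.}$$ *)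

(* Defs.v *)
From HB Require Import structures.
From mathcomp Require Import all_boot all_order all_algebra.
From mathcomp Require Import all_classical all_reals all_analysis.
From mathcomp Require Import measurable_realfun.

Set Implicit Arguments.
Unset Strict Implicit.
Unset Printing Implicit Defensive.

Import Order.TTheory GRing.Theory Num.Theory.
Import numFieldNormedType.Exports.

Local Open Scope classical_set_scope.
Local Open Scope ring_scope.

(* A Hilbert space is a complete normed module with a dot product inducing its
   norm. *)
Definition hilbert_norm (R : realType) (H : completeNormedModType R)
    (ip : {dot H for idfun}) : Prop :=
  forall x, ip x x = `|x| ^+ 2.

Definition separable (T : topologicalType) : Prop :=
  exists S : set T, countable S /\ dense S.

Definition borel (T : topologicalType) : set (set T) := <<s @open T >>.

Notation borelType T := (g_sigma_algebraType (@open T)).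

Definition boundary (T : topologicalType) (A : set T) : set T :=
  closure A `\` interior A.

Section operators.
Context {R : realType} {H : completeNormedModType R}.
Implicit Types (ip : {dot H for idfun}) (D : set H) (A B T S : H -> H).

(* An unbounded operator is a pair (D, A); only the values of A on D matter. *)
Definition linear_operator D A : Prop :=
  [/\ D 0,
      forall (a : R) x y, D x -> D y -> D (a *: x + y) &
      forall (a : R) x y, D x -> D y -> A (a *: x + y) = a *: A x + A y].

(* (y, z) is in the graph of the adjoint iff <A x, y> = <x, z> on D(A). *)
Definition self_adjoint ip D A : Prop :=
  dense D /\
  forall y z, (forall x, D x -> ip (A x) y = ip x z) <-> (D y /\ A y = z).

Definition inverse_operator D A B : Prop :=
  (forall y, D (B y) /\ A (B y) = y) /\ (forall x, D x -> B (A x) = x).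

(* Nuclear representation: T = sum_n <a_n, .> b_n, sum_n |a_n| |b_n| < oo. *)
Definition trace_class ip T : Prop :=
  exists a b : nat -> H,
    (\sum_(0 <= n <oo) (`|a n| * `|b n|)%:E < +oo)%E /\
    forall x, series (fun n => ip (a n) x *: b n) @ \oo --> T x.

Definition positive_sqrt ip T S : Prop :=
  [/\ linear S, continuous S,
      forall x y, ip (S x) y = ip x (S y),
      forall x, 0 <= ip (S x) x &
      forall x, S (S x) = T x].

End operators.

(* The normal law of mean m and variance v >= 0. *)
Definition normal_law {R : realType} (m v : R) (B : set R) : \bar R :=
  if v == 0 then (\d_m B)%E else normal_prob m (Num.sqrt v) B.

Definition gaussian_measure {R : realType} {H : completeNormedModType R}
    (ip : {dot H for idfun}) (mu : set H -> \bar R) (m : H) (Q : H -> H) : Prop :=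
  forall (h : H) (B : set R), measurable B ->
    mu [set x | B (ip h x)] = normal_law (ip h m) (ip (Q h) h) B.

Section smooth.
Context {R : realType} {H : completeNormedModType R}.
Implicit Types (g : H -> R) (G : H -> H).

(* D x [:: h_1; ...; h_k] is the k-th Frechet derivative of g at x applied to
   (h_1, ..., h_k). It is a bounded k-linear form, and D^(k+1) is the derivative
   of D^k for the operator norm of k-linear forms. *)
Definition frechet_derivatives g (D : H -> seq H -> R) : Prop :=
  [/\ forall x, D x [::] = g x,
      forall x v w (a : R) h k,
        D x (v ++ (a *: h + k) :: w) = a * D x (v ++ h :: w) + D x (v ++ k :: w),
      forall x n, exists M : R, forall v, size v = n ->
        `|D x v| <= M * \prod_(y <- v) `|y| &
      forall x n (e : R), 0 < e -> \forall h \near (0 : H),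
        forall v, size v = n ->
          `|D (x + h) v - D x v - D x (h :: v)| <= e * `|h| * \prod_(y <- v) `|y| ].

Definition smooth g : Prop := exists D, frechet_derivatives g D.

Definition gradient (ip : {dot H for idfun}) g G : Prop :=
  forall x, differentiable g x /\ forall h, 'd g x h = ip (G x) h.

(* Here G is the gradient of g, so that 'd G x is the second derivative of g
   at x, seen as an operator on H. The reciprocal is taken in \bar R, where
   0^-1 = +oo. *)
Definition regular_convex (ip : {dot H for idfun}) (mu : probability (borelType H) R)
    (Qhalf : H -> H) (Gamma : set H) g G : Prop :=
  [/\ convex_function [set: H] g /\ smooth g,
      [/\ gradient ip g G, g 0 = 0 & G 0 = 0],
      exists2 gamma : R, 0 < gamma &
        forall x h, gamma * `|h| ^+ 2 <= ip ('d G x h) h,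
      [/\ Gamma = [set x | g x <= 1], boundary Gamma = [set x | g x = 1] &
        exists M : R, forall x, Gamma x -> forall h, `|'d G x h| <= M * `|h| ] &
      forall p : R, 1 < p ->
        let f : borelType H -> \bar R := fun x => (`|Qhalf (G x)|%:E^-1)%E in
        measurable_fun [set: borelType H] f /\ ('N[mu]_(p%:E)[f] < +oo)%E ].

Definition normal_vector G (x : H) : H := `|G x|^-1 *: G x.

End smooth.

Section stieltjes.
Context {R : realType}.

Definition clamp (T t : R) : R := Num.max 0 (Num.min t T).

(* The extension of f from [0, T] to the line by constants, as a cumulative
   function (with a dummy value when it is not one). *)
Definition cumulative_of (T : R) (f : R -> R) : cumulative R R :=
  if pselect (exists F : cumulative R R, (F : R -> R) = f \o clamp T) is left e
  then projT1 (cid e) else idfun.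

Definition dmeas (T : R) (f : R -> R) :=
  lebesgue_stieltjes_measure (cumulative_of T f).

End stieltjes.

Section processes.
Context {R : realType} {d : measure_display} {Omega : measurableType d}.
Context {H : completeNormedModType R}.
Variable P : probability Omega R.
Implicit Types (Ft : R -> set (set Omega)).

Definition filtration Ft : Prop :=
  [/\ forall t, 0 <= t -> sigma_algebra setT (Ft t),
      forall t, 0 <= t -> Ft t `<=` measurable &
      forall s t, 0 <= s -> s <= t -> Ft s `<=` Ft t].

(* W h t stands for <h, W_t>: it is a.s. linear in h, and for each h it is an
   (F_t)-Brownian motion of variance |h|^2 t. *)
Definition cylindrical_wiener Ft (W : H -> R -> Omega -> R) : Prop :=
  [/\ forall (a : R) h k t, 0 <= t ->
        {ae P, forall w, W (a *: h + k) t w = a * W h t w + W k t w},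
      forall h t, 0 <= t -> forall B : set R, measurable B -> Ft t (W h t @^-1` B),
      forall h, {ae P, forall w, W h 0 w = 0 /\
        {within `[0, +oo[, continuous (fun t => W h t w)}} &
      forall h s t, 0 <= s -> s < t -> forall B : set R, measurable B ->
        let I := [set w | B (W h t w - W h s w)] in
        P I = normal_law 0 (`|h| ^+ 2 * (t - s)) B /\
        forall E, Ft s E -> P (E `&` I) = (P E * P I)%E ].

(* The integrand l being deterministic and constant in time, the stochastic
   integral of <l, dW> over [0, t] is W l t. *)
Definition is_solution (ip : {dot H for idfun}) (D : set H) (A : H -> H) (Gamma : set H)
    (n : H -> H) Ft (W : H -> R -> Omega -> R) (T : R) (x : H)
    (X : R -> Omega -> H) (L : R -> Omega -> R) : Prop :=
  [/\ forall t, t \in `[0, T] ->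
        (forall B, borel B -> Ft t (X t @^-1` B)) /\
        (forall B : set R, measurable B -> Ft t (L t @^-1` B)),
      {ae P, forall w, {within `[0, T], continuous (fun t => X t w)} /\
                       {within `[0, T], continuous (fun t => L t w)}},
      {ae P, forall w, forall t, t \in `[0, T] -> Gamma (X t w)},
      {ae P, forall w,
        [/\ L 0 w = 0,
            {in `[0, T] &, {homo (fun t => L t w) : s t / s <= t}} &
            forall B : set R, measurable B -> B `<=` `[0, T] ->
              (\int[dmeas T (fun t => L t w)]_(s in B)
                 (\1_(boundary Gamma) (X s w))%:E =
               dmeas T (fun t => L t w) B)%E ]} &
      forall l, D l -> {ae P, forall w, forall t, t \in `[0, T] ->
        ip l (X t w - x) =
          W l t w
          - \int[dmeas T (fun t => L t w)]_(s in `[0, t]) ip l (n (X s w))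
          - \int[lebesgue_measure]_(s in `[0, t]) ip (A l) (X s w)} ].

End processes.

(* Main.v *)
Require Import Defs.
From HB Require Import structures.
From mathcomp Require Import all_boot all_order all_algebra.
From mathcomp Require Import all_classical all_reals all_analysis.
From mathcomp Require Import measurable_realfun.
From mathcomp Require Import ring lra.

(** Subtracting the two equations removes the noise: for [l] in the domain of
    [A], the path [z = u - v] satisfies, outside a negligible event,
      d<l, z> = - <l, n(u)> dL1 + <l, n(v)> dL2 - <A l, z> dt.
    So everything happens path by path, for deterministic continuous functions,
    and formally d|z|^2 = - 2 <z, n(u)> dL1 + 2 <z, n(v)> dL2 - 2 <A z, z> dt.
    Each term is nonpositive: [L1] only grows when [u] is on the boundary, where
    [n(u)] is an exterior normal of the convex set containing [v], likewise for
    [L2], and [A] is positive. Hence [z = 0].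

    Since [z] need not take values in the domain of [A], the energy is
    mollified. Put [B = A^-1], [C = 1 - delta B] (the map [damp]) and [J_n = 1 - C^n = B q_n],
    where [q_n = delta (1 + C + ... + C^(n-1))] is bounded and nonnegative.
    Then [J_n] is symmetric, takes values in the domain of [A], and
    [A J_n = q_n >= 0]. Coercivity of [A] makes [C] a firmly nonexpansive
    symmetric operator, so that [C^n] tends strongly to 0 by a telescoping
    argument ([iter_damp_cvg0]).
    As [z([0, T])] is compact, [J_n z] is uniformly close to [z].

    The chain rule is replaced by increments. On a short interval [[a, b]],
      <J_n z_b, z_b> - <J_n z_a, z_a> = <B q_n (z_a + z_b), z_b - z_a>,
    which is the equation tested against the constant vector
    [B q_n (z_a + z_b)], close to [2 z_s] for all [s] in [[a, b]]. Hence each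
    integral over [[a, b]] is bounded using only pointwise bounds on its
    integrand ([stieltjes_primitive]), and the local inequalities add up
    ([le_of_local_increments], [energy_small], [paths_agree]). The test vector
    may be approximated by [B h] with [h] in a countable dense set, so a single
    negligible event suffices ([ae_countable]).

    Once [u = v], the equation says that [n(u) dL1 = n(u) dL2] as vector
    measures. Convexity and [g 0 = 0] keep [|Dg|] away from 0 on the boundary
    along a bounded path, so the unit normal extends to a continuous field
    [psi] along the path; pairing both measures with [psi], again on short
    intervals, gives [L1 = L2] ([integrator_unique]). *)

Import Order.TTheory GRing.Theory Num.Theory.
Import numFieldNormedType.Exports.

Local Open Scope classical_set_scope.
Local Open Scope ring_scope.

Set Implicit Arguments.
Unset Strict Implicit.
Unset Printing Implicit Defensive.

(** * Inner products *)

Section inner_product.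
Context {R : realType} {H : completeNormedModType R}.
Variable ip : {dot H for idfun}.
Hypothesis ip_norm : hilbert_norm ip.

Lemma ip_sym x y : ip x y = ip y x.
Proof. by rewrite hermC /= expr0 mul1r. Qed.

Lemma ipDr x y z : ip x (y + z) = ip x y + ip x z.
Proof. by rewrite raddfD. Qed.

Lemma ipNr x y : ip x (- y) = - ip x y.
Proof. by rewrite raddfN. Qed.

Lemma ipBr x y z : ip x (y - z) = ip x y - ip x z.
Proof. by rewrite ipDr ipNr. Qed.

Lemma ipZr a x y : ip x (a *: y) = a * ip x y.
Proof. by rewrite linearZ. Qed.

Lemma ipDl x y z : ip (x + y) z = ip x z + ip y z.
Proof. by rewrite ip_sym ipDr !(ip_sym z). Qed.

Lemma ipNl x y : ip (- x) y = - ip x y.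
Proof. by rewrite ip_sym ipNr ip_sym. Qed.

Lemma ipBl x y z : ip (x - y) z = ip x z - ip y z.
Proof. by rewrite ipDl ipNl. Qed.

Lemma ipZl a x y : ip (a *: x) y = a * ip x y.
Proof. by rewrite ip_sym ipZr ip_sym. Qed.

Lemma ip0l x : ip 0 x = 0.
Proof. by rewrite -(scale0r 0) ipZl mul0r. Qed.

Lemma cauchy_schwarz x y : `|ip x y| <= `|x| * `|y|.
Proof.
have [->|x0] := eqVneq x 0; first by rewrite ip0l !normr0 mul0r.
have [->|y0] := eqVneq y 0; first by rewrite ip_sym ip0l !normr0 mulr0.
have px : 0 < `|x| by rewrite normr_gt0.
have py : 0 < `|y| by rewrite normr_gt0.
have pxy : 0 < `|x| * `|y| by rewrite mulr_gt0.
have expand (e : R) : `|(`|y| *: x) + ((e * `|x|) *: y)| ^+ 2 =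
    `|x| ^+ 2 * `|y| ^+ 2 * (1 + e ^+ 2) + 2 * e * (`|x| * `|y|) * ip x y.
  rewrite -(ip_norm (_ + _)) !(ipDl, ipDr, ipZl, ipZr) !ip_norm (ip_sym y x).
  by ring.
have h1 := sqr_ge0 `|(`|y| *: x) + ((1 * `|x|) *: y)|.
have h2 := sqr_ge0 `|(`|y| *: x) + ((-1 * `|x|) *: y)|.
rewrite !expand in h1 h2.
rewrite ler_norml; apply/andP; split; rewrite -(ler_pM2l pxy); nra.
Qed.

Lemma ip_le x y : ip x y <= `|x| * `|y|.
Proof. exact: le_trans (ler_norm _) (cauchy_schwarz x y). Qed.

Lemma ip_ge x y : - (`|x| * `|y|) <= ip x y.
Proof. by have := cauchy_schwarz x y; rewrite ler_norml => /andP[]. Qed.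

Lemma ip_continuous x : continuous (ip x).
Proof.
move=> y; apply/cvgrPdist_le => e e0; near=> z.
rewrite -ipBr (le_trans (cauchy_schwarz _ _))//.
have x1 : 0 < `|x| + 1 by rewrite ltr_wpDl.
apply: (@le_trans _ _ ((`|x| + 1) * `|y - z|)); first by rewrite ler_wpM2r ?lerDl.
rewrite -ler_pdivlMl//; near: z; apply: cvgr_dist_le; first exact: cvg_id.
by rewrite mulr_gt0 ?invr_gt0.
Unshelve. all: by end_near. Qed.

End inner_product.

(** * Mollification by an inverse operator *)

Section smoothing.
Context {R : realType} {H : completeNormedModType R}.
Variable ip : {dot H for idfun}.
Hypothesis ip_norm : hilbert_norm ip.
Variables (delta : R) (B : {linear H -> H}).
Hypothesis delta_gt0 : 0 < delta.
Hypothesis B_sym : forall x y, ip (B x) y = ip x (B y).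
Hypothesis B_coercive : forall x, delta * `|B x| ^+ 2 <= ip (B x) x.
Hypothesis B_dense : dense (range B).

(** [B] plays the role of [A^-1]: coercivity of [A] reads
    [delta |B x|^2 <= <B x, x>]. *)
Lemma inverse_bounded x : delta * `|B x| <= `|x|.
Proof.
have [->|Bx0] := eqVneq (B x) 0; first by rewrite normr0 mulr0.
have := le_trans (B_coercive x) (ip_le ip_norm _ _).
by rewrite expr2 mulrCA ler_pM2l ?normr_gt0.
Qed.

Definition damp x := x - delta *: B x.

Lemma dampB x y : damp (x - y) = damp x - damp y.
Proof. by rewrite /damp linearB scalerBr !opprB addrACA [RHS]addrACA (addrC (- y)). Qed.

Lemma iter_dampB n x y : iter n damp (x - y) = iter n damp x - iter n damp y.
Proof. by elim: n => //= n ->; rewrite dampB. Qed.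

Lemma iter_damp0 n : iter n damp 0 = 0.
Proof. by rewrite -[in LHS](subrr 0) iter_dampB subrr. Qed.

Lemma iter_dampD n x y : iter n damp (x + y) = iter n damp x + iter n damp y.
Proof.
have opp z : iter n damp (- z) = - iter n damp z.
  by rewrite -[- z]sub0r iter_dampB iter_damp0 sub0r.
by rewrite -[in LHS](opprK y) iter_dampB opp opprK.
Qed.

Lemma damp_sym x y : ip (damp x) y = ip x (damp y).
Proof. by rewrite /damp ipBl ipBr ipZl ipZr B_sym. Qed.

Lemma iter_damp_sym n x y : ip (iter n damp x) y = ip x (iter n damp y).
Proof. by elim: n x y => //= n IH x y; rewrite damp_sym IH -iterSr. Qed.

(** With [C] for [damp], this is [C^2 <= C] between symmetric operators: since
    [1 - C = delta B], the difference of the two sides is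
    [delta (<x, B x> - delta |B x|^2)]. It yields both the contraction property
    and the positivity of all the powers of [C]. *)
Lemma damp_firmly_nonexpansive x : `|damp x| ^+ 2 <= ip (damp x) x.
Proof.
rewrite -ip_norm -subr_ge0 -ipBr {2}/damp opprB addrC subrK.
rewrite /damp ipBl !(ipZr, ipZl) (ip_sym ip x) ip_norm -mulrBr.
by rewrite pmulr_rge0// subr_ge0.
Qed.

Lemma damp_contraction x : `|damp x| <= `|x|.
Proof.
have [->|Cx0] := eqVneq (damp x) 0; first by rewrite normr0.
have := le_trans (damp_firmly_nonexpansive x) (ip_le ip_norm _ _).
by rewrite expr2 ler_pM2l ?normr_gt0.
Qed.

Lemma iter_damp_contraction n x : `|iter n damp x| <= `|x|.
Proof. by elim: n => //= n; apply: le_trans; exact: damp_contraction. Qed.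

(** An even power is a square, and an odd power is [C] conjugated by a power. *)
Lemma iter_damp_ge0 n x : 0 <= ip (iter n damp x) x.
Proof.
rewrite -(odd_double_half n) -addnn addnCA addnC; set m := n./2.
rewrite iterD iter_damp_sym ip_sym.
case: (odd n) => /=; last by rewrite ip_norm sqr_ge0.
by apply: le_trans (damp_firmly_nonexpansive _); rewrite sqr_ge0.
Qed.

Lemma damp_decrement x :
  `|delta *: B x| ^+ 2 <= `|x| ^+ 2 - `|damp x| ^+ 2.
Proof.
have -> : delta *: B x = x - damp x by rewrite /damp opprB addrC subrK.
move: (damp x) (damp_firmly_nonexpansive x) => y h.
rewrite -(ip_norm (x - y)) !(ipBl, ipBr) (ip_sym ip x y) !ip_norm.
by lra.
Qed.

Lemma iter_damp_comm n x : iter n damp (delta *: B x) = delta *: B (iter n damp x).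
Proof.
elim: n => //= n ->; move: (iter n damp x) => w.
by rewrite /damp linearB scalerBr !linearZ.
Qed.

(** The squares [|C^k x|^2] decrease by at least [|C^k (delta B x)|^2] at each
    step, and these decrements are themselves nonincreasing in [k]; their sum is
    at most [|x|^2]. *)
Lemma iter_damp_range n x :
  n%:R * `|iter n damp (delta *: B x)| ^+ 2 <= `|x| ^+ 2.
Proof.
suff : n%:R * `|iter n damp (delta *: B x)| ^+ 2 + `|iter n damp x| ^+ 2
    <= `|x| ^+ 2 by apply: le_trans; rewrite lerDl sqr_ge0.
elim: n => [|n IH] /=; first by rewrite mul0r add0r.
apply: le_trans IH; have := damp_decrement (iter n damp x).
rewrite -iter_damp_comm; set y := iter n damp (delta *: B x) => h.
have h2 : `|damp y| ^+ 2 <= `|y| ^+ 2.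
  by rewrite ler_pXn2r ?nnegrE// damp_contraction.
have : n.+1%:R * `|damp y| ^+ 2 <= n.+1%:R * `|y| ^+ 2 by rewrite ler_wpM2l.
rewrite -[n.+1]addn1 natrD !mulrDl !mul1r.
by lra.
Qed.

(** The previous bound gives the convergence on the range of [B]; density and the
    contraction property extend it to the whole space. *)
Lemma iter_damp_cvg0 x : iter n damp x @[n --> \oo] --> (0 : H).
Proof.
apply/cvgrPdist_lt => e e0.
have e20 : 0 < e / 2 by rewrite divr_gt0.
have [_ [/[swap] -[y _ <-]]] : ball x (e / 2) `&` range B !=set0.
  by apply: B_dense; [exists x; exact: ballxx|exact: ball_open].
rewrite -ball_normE /= => xBy.
near=> n; rewrite sub0r normrN.
have -> : x = (x - B y) + delta *: B (delta^-1 *: y).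
  by rewrite linearZ scalerA mulfV ?gt_eqF// scale1r subrK.
rewrite iter_dampD (le_lt_trans (ler_normD _ _))// [ltRHS]splitr.
apply: ltr_leD; first exact: le_lt_trans (iter_damp_contraction _ _) xBy.
have := iter_damp_range n (delta^-1 *: y); set r := `|delta^-1 *: y|.
set p := `|iter n damp _| => h.
have n0 : 0 < n%:R :> R by rewrite ltr0n; near: n; exists 1%N.
suff : n%:R * p ^+ 2 <= n%:R * (e / 2) ^+ 2.
  rewrite ler_pM2l// ler_pXn2r//; first by rewrite nnegrE normr_ge0.
  by rewrite nnegrE ltW.
apply: le_trans h _.
rewrite -ler_pdivrMr ?exprn_gt0//; near: n; exact: nbhs_infty_ger.
Unshelve. all: by end_near. Qed.

(** The bounded operator [q_n], which is [A J_n] for [J_n = 1 - C^n]; it is the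
    truncated Neumann series of [A = delta (1 - C)^-1]. *)
Definition mollify n x := delta *: \sum_(k < n) iter k damp x.

Lemma inverse_mollify n x : B (mollify n x) = x - iter n damp x.
Proof.
rewrite /mollify linearZ /=; elim: n => [|n IH].
  by rewrite big_ord0 linear0 scaler0 subrr.
rewrite big_ord_recr linearD scalerDr IH /=; move: (iter n damp x) => w.
by rewrite /damp opprB -addrA (addrC (- w)).
Qed.

Lemma mollifyD n x y : mollify n (x + y) = mollify n x + mollify n y.
Proof.
rewrite /mollify -scalerDr -big_split /=; congr (_ *: _).
by apply: eq_bigr => k _; rewrite iter_dampD.
Qed.

Lemma mollify_bounded n x : `|mollify n x| <= delta * n%:R * `|x|.
Proof.
rewrite /mollify normrZ gtr0_norm// -mulrA ler_pM2l//.
apply: le_trans (ler_norm_sum _ _ _) _.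
apply: (@le_trans _ _ (\sum_(k < n) `|x|)).
  by apply: ler_sum => k _; exact: iter_damp_contraction.
by rewrite sumr_const card_ord mulr_natl.
Qed.

Lemma mollify_ge0 n x : 0 <= ip (mollify n x) x.
Proof.
rewrite /mollify ipZl pmulr_rge0// ip_sym linear_sum /= sumr_ge0// => k _.
by rewrite ip_sym iter_damp_ge0.
Qed.

End smoothing.

(** * Continuous paths on a segment *)

Section paths.
Context {R : realType}.

(** This is what replaces differentiation: an inequality between increments that
    holds on all short intervals propagates by summation over a uniform
    partition. *)
Lemma le_of_local_increments (T d : R) (F G : R -> R) : 0 < d ->
  (forall a b, 0 <= a -> a <= b -> b <= T -> b - a < d ->
     F b - F a <= G b - G a) ->
  forall t, 0 <= t -> t <= T -> F t - F 0 <= G t - G 0.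
Proof.
move=> d0 FG t t0 tT.
have [n tn] : exists n : nat, t / d < n.+1%:R.
  exists (Num.bound (t / d)); apply: lt_le_trans (archi_boundP _) _.
    exact: divr_ge0 t0 (ltW d0).
  by rewrite ler_nat.
have n0 : 0 < n.+1%:R :> R by rewrite ltr0n.
pose s k := t * k%:R / n.+1%:R.
have sS k : s k.+1 - s k = t / n.+1%:R.
  by rewrite /s -[k.+1]addn1 natrD mulrDr mulr1 mulrDl addrAC subrr add0r.
suff h k : (k <= n.+1)%N -> F (s k) - F 0 <= G (s k) - G 0.
  have -> : t = s n.+1 by rewrite /s mulfK// gt_eqF.
  exact: h.
elim: k => [_|k IH kn]; first by rewrite /s mulr0 mul0r !subrr.
have := IH (ltnW kn).
suff : F (s k.+1) - F (s k) <= G (s k.+1) - G (s k) by lra.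
apply: FG.
- by rewrite /s !mulr_ge0 ?invr_ge0.
- by rewrite -subr_ge0 sS divr_ge0.
- apply: le_trans tT; rewrite /s ler_pdivrMr// ler_wpM2l//.
  by rewrite ler_nat.
- by rewrite sS ltr_pdivrMr// mulrC -ltr_pdivrMr.
Qed.

Context {V : normedModType R}.
Variables (T : R) (f : R -> V).
Hypothesis f_cont : {within `[0, T], continuous f}.

Let f_at s : `[0, T]%classic s -> forall e, 0 < e ->
  \forall r \near s, `[0, T]%classic r -> `|f s - f r| < e.
Proof.
move=> sT e e0; have /subspace_continuousP/(_ s sT) := f_cont.
by move/cvgrPdist_lt => /(_ e e0).
Qed.

Let segment_near_covering : near_covering_within `[0, T]%classic.
Proof.
by apply/near_covering_withinP/compact_near_coveringP; exact: segment_compact.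
Qed.

Lemma path_bounded :
  exists2 M, 0 < M & forall s, `[0, T]%classic s -> `|f s| <= M.
Proof.
have : \forall M \near +oo, `[0, T]%classic `<=` (fun s => `|f s| <= M).
  apply: (segment_near_covering (I := R) (F := (pinfty_nbhs R))).
  move=> s sT; near=> r M.
  have fsM : `|f s| + 1 <= M by near: M; exact: nbhs_pinfty_ge.
  suff h : `[0, T]%classic r -> `|f s - f r| < 1.
    move=> /h {}h.
    have -> : f r = f s - (f s - f r) by rewrite opprB addrC subrK.
    apply: le_trans (ler_normB _ _) _; apply: le_trans fsM.
    by rewrite lerD2l ltW.
  by near: r; exact: f_at.
move=> h; near (pinfty_nbhs R) => M; exists M; last by near: M.
by near: M; exact: nbhs_pinfty_gt.
Unshelve. all: by end_near. Qed.

Lemma path_unif_continuous e : 0 < e -> exists2 d, 0 < d &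
  forall a b, `[0, T]%classic a -> `[0, T]%classic b -> `|b - a| < d ->
    `|f b - f a| < e.
Proof.
move=> e0.
have : \forall d \near (0 : R)^'+, `[0, T]%classic `<=` (fun a =>
    forall b, `[0, T]%classic b -> `|b - a| < d -> `|f b - f a| < e).
  apply: (segment_near_covering (I := R) (F := ((0:R)^'+))).
  move=> s sT.
  have e20 : 0 < e / 2 by rewrite divr_gt0.
  have /nbhs_ballP[r /= r0 rs] := f_at sT e20.
  have r20 : 0 < r / 2 by rewrite divr_gt0.
  near=> a d.
  have sa : `|s - a| < r / 2.
    by near: a; apply: cvgr_dist_lt => //; exact: cvg_id.
  have dr : d < r / 2 by near: d; exact: nbhs_right_lt.
  move=> aT b bT bad.
  have -> : f b - f a = (f s - f a) - (f s - f b).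
    by rewrite opprB [RHS]addrC addrA subrK.
  apply: le_lt_trans (ler_normB _ _) _; rewrite [ltRHS]splitr.
  apply: ltrD; apply: rs => //=; rewrite /ball /=.
    by apply: lt_trans sa _; rewrite ltr_pdivrMr// ltr_pMr// ltr1n.
  have -> : s - b = (s - a) - (b - a) by rewrite opprB addrA subrK.
  apply: le_lt_trans (ler_normB _ _) _; rewrite [ltRHS]splitr.
  by apply: ltrD => //; exact: lt_trans bad dr.
move=> h; near (0:R)^'+ => d; exists d => //.
move=> a b aT bT; have : `[0, T]%classic `<=` (fun a =>
    forall b, `[0, T]%classic b -> `|b - a| < d -> `|f b - f a| < e) by near: d.
by move=> /(_ a aT b bT).
Unshelve. all: by end_near. Qed.

(** A bounded family of operators converging pointwise converges uniformly on
    compact sets, here on the range of the path. *)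
Lemma uniform_cvg0_path (C : nat -> V -> V) :
  (forall n x y, C n (x - y) = C n x - C n y) ->
  (forall n x, `|C n x| <= `|x|) ->
  (forall x, C n x @[n --> \oo] --> (0 : V)) ->
  forall e, 0 < e ->
    exists n, forall s, `[0, T]%classic s -> `|C n (f s)| < e.
Proof.
move=> CB C1 C0 e e0.
have : \forall n \near \oo, `[0, T]%classic `<=` (fun s => `|C n (f s)| < e).
  apply: (segment_near_covering (I := nat) (F := \oo)).
  move=> s sT; have e20 : 0 < e / 2 by rewrite divr_gt0.
  near=> r n.
  have Cs : `|0 - C n (f s)| < e / 2.
    by near: n; move: (C0 (f s)) => /cvgrPdist_lt; exact.
  have fr : `[0, T]%classic r -> `|f s - f r| < e / 2 by near: r; exact: f_at.
  move=> /fr {}fr.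
  have -> : f r = f s - (f s - f r) by rewrite opprB addrC subrK.
  rewrite CB; apply: le_lt_trans (ler_normB _ _) _; rewrite [ltRHS]splitr.
  apply: ltrD; first by move: Cs; rewrite sub0r normrN.
  exact: le_lt_trans (C1 _ _) fr.
by case=> n _ /(_ n (leqnn n)) h; exists n.
Unshelve. all: by end_near. Qed.

End paths.

(** * Uniqueness of the path *)

(** All that the argument retains of [I t = \int_[0, t] f dL], for an integrator
    [L] that grows only on [E]: on an interval where [f] is bounded by a constant
    on [E], so is the increment of [I], relatively to that of [L]. *)
Definition stieltjes_primitive {R : realType} (T : R) (E : set R)
    (L f I : R -> R) : Prop :=
  I 0 = 0 /\
  forall a b c, 0 <= a -> a <= b -> b <= T ->
    ((forall s, a <= s <= b -> E s -> c <= f s) ->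
       c * (L b - L a) <= I b - I a) /\
    ((forall s, a <= s <= b -> E s -> f s <= c) ->
       I b - I a <= c * (L b - L a)).

Lemma le0_small {R : realType} (x c : R) :
  (forall e, 0 < e -> x <= e * c) -> x <= 0.
Proof.
move=> h; have [//|x0] := leP x 0.
have c1 : 0 < `|c| + 1 by rewrite ltr_wpDl.
have := h (x / (2 * (`|c| + 1))); rewrite divr_gt0 ?mulr_gt0// => /(_ isT).
move=> /le_trans /(_ (_ : _ <= x / (2 * (`|c| + 1)) * (`|c| + 1))).
rewrite ler_pM2l ?divr_gt0 ?mulr_gt0//.
have -> : c <= `|c| + 1 by rewrite (le_trans (ler_norm _))// lerDl.
move=> /(_ isT); rewrite invfM mulrA divfK ?gt_eqF// => h2.
have : x / 2 < x by rewrite ltr_pdivrMr// ltr_pMr// ltr1n.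
by rewrite ltNge h2.
Qed.

Section pathwise.
Context {R : realType} {H : completeNormedModType R}.
Variable ip : {dot H for idfun}.
Hypothesis ip_norm : hilbert_norm ip.

Lemma ortho_dense (S : set H) x :
  dense S -> (forall h, S h -> ip h x = 0) -> x = 0.
Proof.
move=> Sd Sx; apply/normr0_eq0/eqP; rewrite -sqrf_eq0 eq_le sqr_ge0 andbT.
apply: (@le0_small _ _ `|x|) => e e0.
have [h []] : ball x e `&` S !=set0.
  by apply: Sd; [exists x; exact: ballxx|exact: ball_open].
rewrite -ball_normE /= => xh Sh.
have -> : `|x| ^+ 2 = ip (x - h) x by rewrite ipBl (Sx h Sh) subr0 ip_norm.
by apply: le_trans (ip_le ip_norm _ _) _; rewrite ler_wpM2r// ltW.
Qed.

Variables (delta : R) (B : {linear H -> H}).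
Hypothesis delta_gt0 : 0 < delta.
Hypothesis B_sym : forall x y, ip (B x) y = ip x (B y).
Hypothesis B_coercive : forall x, delta * `|B x| ^+ 2 <= ip (B x) x.
Hypothesis B_dense : dense (range B).
Variable S : set H.
Hypothesis S_dense : dense S.

Lemma approx x e : 0 < e -> exists2 h, S h & `|x - h| < e.
Proof.
move=> e0; have [h []] : ball x e `&` S !=set0.
  by apply: S_dense; [exists x; exact: ballxx|exact: ball_open].
by rewrite -ball_normE /= => xh Sh; exists h.
Qed.

Let B_le x : `|B x| <= delta^-1 * `|x|.
Proof. by rewrite ler_pdivlMl// (inverse_bounded ip_norm). Qed.

Lemma dense_image_inverse : dense (B @` S).
Proof.
move=> O [x Ox] Oo.
have [e /= e0 xe] := (nbhs_ballP _ _).1 (open_nbhs_nbhs (conj Oo Ox)).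
have e20 : 0 < e / 2 by rewrite divr_gt0.
have [_ [/[swap] -[y _ <-]]] : ball x (e / 2) `&` range B !=set0.
  by apply: B_dense; [exists x; exact: ballxx|exact: ball_open].
rewrite -ball_normE /= => xBy.
have [h Sh yh] := @approx y (delta * (e / 2)) (mulr_gt0 delta_gt0 e20).
exists (B h); split; last by exists h.
apply: xe; rewrite -ball_normE /=.
have -> : x - B h = (x - B y) + B (y - h) by rewrite linearB addrA subrK.
apply: le_lt_trans (ler_normD _ _) _; rewrite [ltRHS]splitr; apply: ltrD => //.
by apply: le_lt_trans (B_le _) _; rewrite ltr_pdivrMl.
Qed.

Variable T : R.
Variables (u v : R -> H) (L1 L2 : R -> R).
Hypothesis u_cont : {within `[0, T], continuous u}.
Hypothesis v_cont : {within `[0, T], continuous v}.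
Hypothesis L1_nd : forall a b, 0 <= a -> a <= b -> b <= T -> L1 a <= L1 b.
Hypothesis L2_nd : forall a b, 0 <= a -> a <= b -> b <= T -> L2 a <= L2 b.
Hypothesis L10 : L1 0 = 0.
Hypothesis L20 : L2 0 = 0.
Variables (Gamma bd : set H) (N : H -> H).
Hypothesis N_le1 : forall x, `|N x| <= 1.
Hypothesis N_normal : forall x y, bd x -> Gamma y -> 0 <= ip (N x) (x - y).
Hypothesis u_Gamma : forall s, 0 <= s -> s <= T -> Gamma (u s).
Hypothesis v_Gamma : forall s, 0 <= s -> s <= T -> Gamma (v s).
Variables I1 I2 K : H -> R -> R.
Hypothesis I1P : forall h, S h -> stieltjes_primitive T [set s | bd (u s)] L1
  (fun s => ip (B h) (N (u s))) (I1 h).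
Hypothesis I2P : forall h, S h -> stieltjes_primitive T [set s | bd (v s)] L2
  (fun s => ip (B h) (N (v s))) (I2 h).
Hypothesis KP : forall h, S h -> stieltjes_primitive T setT id
  (fun s => ip h (u s - v s)) (K h).
Hypothesis balance : forall h, S h -> forall t, 0 <= t -> t <= T ->
  ip (B h) (u t - v t) = - I1 h t + I2 h t - K h t.

Let z s := u s - v s.

Let z_cont : {within `[0, T], continuous z}.
Proof. by move=> s; apply: continuousB; [exact: u_cont|exact: v_cont]. Qed.

Lemma start_equal : 0 <= T -> z 0 = 0.
Proof.
move=> T0; apply: (ortho_dense dense_image_inverse) => _ [h Sh <-].
rewrite /z balance// (I1P Sh).1 (I2P Sh).1 (KP Sh).1.
by rewrite oppr0 !addr0.
Qed.

Let J n x := x - iter n (damp delta B) x.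

(** The polarization identity [<J b, b> - <J a, a> = <J (a + b), b - a>] of a
    symmetric operator: the increment of the energy is the increment of [z]
    tested against a vector of the domain of [A]. *)
Lemma mollified_energy_difference n a b :
  ip (J n (z b)) (z b) - ip (J n (z a)) (z a) =
  ip (B (mollify delta B n (z a + z b))) (z b - z a).
Proof.
rewrite inverse_mollify iter_dampD /J; move: (z a) (z b) => p q.
rewrite !(ipBl, ipBr, ipDl, ipDr) !(iter_damp_sym delta B_sym) (ip_sym ip q p).
rewrite (ip_sym ip q (iter _ _ p)) (iter_damp_sym delta B_sym).
by lra.
Qed.

(** Every term of the increment of the energy is nonpositive up to an error
    proportional to [e]. For the reflection terms the error comes from
    [|B h - 2 z_s|], bounded by [(delta^-1 + 4) e]; for the drift it comes from
    comparing [<h, z_s>] with [2 <q_n z_s, z_s> >= 0]. *)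
Lemma energy_small t e : 0 <= t -> t <= T -> 0 < e ->
  exists n,
    (forall s, 0 <= s -> s <= T -> `|iter n (damp delta B) (z s)| < e) /\
  forall M, (forall s, 0 <= s -> s <= T -> `|z s| <= M) ->
    ip (J n (z t)) (z t) <= e * ((delta^-1 + 4) * (L1 t + L2 t) + 3 * M * t).
Proof.
move=> t0 tT e0.
have [n Cn] := uniform_cvg0_path z_cont (iter_dampB delta B)
  (iter_damp_contraction ip_norm delta_gt0 B_coercive)
  (iter_damp_cvg0 ip_norm delta_gt0 B_coercive B_dense) e0.
have {}Cn s : 0 <= s -> s <= T -> `|iter n (damp delta B) (z s)| < e.
  by move=> s0 sT; apply: Cn; rewrite /= in_itv /= s0.
exists n; split => // M zM.
pose k := delta^-1 + 4.
have dn0 : 0 <= delta * n%:R := mulr_ge0 (ltW delta_gt0) (ler0n _ _).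
have dn : 0 < delta * n%:R + 1 by rewrite ltr_wpDl.
pose e2 := e / (delta * n%:R + 1).
have e20 : 0 < e2 by rewrite divr_gt0.
have e2e : e2 <= e.
  by rewrite ler_pdivrMr// mulrDr mulr1 lerDr mulr_ge0// ltW.
(* The norm of [q_n] is at most [delta n], whence the finer modulus [e2]. *)
have [d d0 dz] := path_unif_continuous z_cont e20.
pose F s := ip (J n (z s)) (z s).
pose G s := k * e * (L1 s + L2 s) + 3 * e * M * s.
suff h : F t - F 0 <= G t - G 0.
  have F0 : F 0 = 0 by rewrite /F start_equal ?(le_trans t0)// ip_sym ip0l.
  have G0 : G 0 = 0 by rewrite /G L10 L20 addr0 !mulr0 addr0.
  by rewrite F0 G0 !subr0 /F /G /k in h; apply: le_trans h _; lra.
apply: (le_of_local_increments d0 _ t0 tT) => a b a0 ab bT bad.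
have aT := le_trans ab bT; have b0 := le_trans a0 ab.
rewrite mollified_energy_difference.
set y := mollify delta B n (z a + z b); set w := z b - z a.
have near_z r s : 0 <= r -> r <= T -> 0 <= s -> s <= T -> `|s - r| < d ->
    `|z s - z r| < e2.
  by move=> r0 rT s0 sT; apply: dz; rewrite /= in_itv /= ?r0 ?s0.
have dist s : a <= s <= b -> `|z a - z s| < e2 /\ `|z b - z s| < e2.
  move=> /andP[sa sb]; split; apply: near_z => //; try lra.
    by rewrite ltr_norml; apply/andP; split; lra.
  by rewrite ltr_norml; apply/andP; split; lra.
(* [e3] pays for replacing [y] by the element [h] of the dense set. *)
apply/ler_addgt0Pr => e3 e30.
have w1 : 0 < `|w| + 1 by rewrite ltr_wpDl.
pose r := Num.min e (delta * (e3 / (`|w| + 1))).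
have r0 : 0 < r by rewrite lt_min e0 mulr_gt0// divr_gt0.
have [h Sh yh] := approx y r0.
have yhe : `|y - h| < e by rewrite (lt_le_trans yh)// ge_min lexx.
have Byh : `|B (y - h)| <= e / delta.
  by apply: le_trans (B_le _) _; rewrite mulrC ler_pM2r ?invr_gt0// ltW.
have -> : ip (B y) w = ip (B h) w + ip (B (y - h)) w.
  by rewrite -ipDl -[in RHS]linearD (addrC h) subrK.
apply: lerD; last first.
  apply: le_trans (ip_le ip_norm _ _) _.
  apply: (@le_trans _ _ (e3 / (`|w| + 1) * (`|w| + 1))); last first.
    by rewrite divfK// gt_eqF.
  apply: ler_pM => //; last by rewrite lerDl.
  apply: le_trans (B_le _) _; rewrite ler_pdivrMl// ltW//.
  by rewrite (lt_le_trans yh)// ge_min lexx orbT.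
have -> : ip (B h) w = - (I1 h b - I1 h a) + (I2 h b - I2 h a) - (K h b - K h a).
  by rewrite /w ipBr !balance//; lra.
have Bhz s : a <= s <= b -> `|B h - 2 *: z s| <= k * e.
  move=> sab; have [h1 h2] := dist s sab.
  have -> : B h - 2 *: z s = (z a - z s) + (z b - z s)
      - B (y - h) - (iter n (damp delta B) (z a) + iter n (damp delta B) (z b)).
    rewrite (linearB B y h) scaler_nat mulr2n.
    have : z a + z b = B y + (iter n (damp delta B) (z a)
        + iter n (damp delta B) (z b)).
      by rewrite inverse_mollify -iter_dampD subrK.
    move: (B y) (B h) (z a) (z b) (z s) => p q r1 r2 r3 E.
    rewrite addrACA -opprD E opprB.
    move: (iter _ _ _ + iter _ _ _) (r3 + r3) => c r4.
    by rewrite [RHS]addrAC (addrAC (p + c)) addrK [RHS]addrC addrA subrK.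
  apply: le_trans (ler_normB _ _) _.
  apply: le_trans (lerD (ler_normB _ _) (ler_normD _ _)) _.
  apply: le_trans (lerD (lerD (ler_normD _ _) (lexx _)) (lexx _)) _.
  have := Cn a a0 aT; have := Cn b b0 bT; rewrite /k.
  by move: Byh; rewrite [e / delta]mulrC; lra.
have zu s : a <= s <= b -> bd (u s) -> - (k * e) <= ip (B h) (N (u s)).
  move=> sab bu; have /andP[sa sb] := sab.
  have -> : B h = (B h - 2 *: z s) + 2 *: z s by rewrite subrK.
  rewrite ipDl ipZl.
  have p1 : 0 <= ip (z s) (N (u s)).
    by rewrite ip_sym; apply: N_normal => //; apply: v_Gamma; lra.
  have p2 := ip_ge ip_norm (B h - 2 *: z s) (N (u s)).
  have p3 : `|B h - 2 *: z s| * `|N (u s)| <= k * e.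
    by apply: le_trans (Bhz s sab); rewrite ler_piMr.
  by lra.
have zv s : a <= s <= b -> bd (v s) -> ip (B h) (N (v s)) <= k * e.
  move=> sab bv; have /andP[sa sb] := sab.
  have -> : B h = (B h - 2 *: z s) + 2 *: z s by rewrite subrK.
  rewrite ipDl ipZl.
  have p1 : 0 <= - ip (z s) (N (v s)).
    rewrite ip_sym -ipNr opprB; apply: N_normal => //; apply: u_Gamma; lra.
  have p2 := ip_le ip_norm (B h - 2 *: z s) (N (v s)).
  have p3 : `|B h - 2 *: z s| * `|N (v s)| <= k * e.
    by apply: le_trans (Bhz s sab); rewrite ler_piMr.
  by lra.
have zz s : a <= s <= b -> setT s -> - (3 * e * M) <= ip h (u s - v s).
  move=> sab _; have [h1 h2] := dist s sab; have /andP[sa sb] := sab.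
  rewrite -/(z s).
  pose q := mollify delta B n.
  have yE : y = q (z a - z s + (z b - z s)) + q (z s) + q (z s).
    rewrite /y /q -!mollifyD -(addrA (_ + _)) (addrACA _ _ (z s)).
    by rewrite !subrK.
  have -> : h = (h - y) + (q (z a - z s + (z b - z s)) + q (z s) + q (z s)).
    by rewrite -yE subrK.
  have zsM : `|z s| <= M by apply: zM; lra.
  have M0 := le_trans (normr_ge0 _) zsM.
  have := mollify_ge0 ip_norm delta_gt0 B_sym B_coercive n (z s).
  rewrite -/q (ipDl ip (h - y)) (ipDl ip (q _ + q _)).
  rewrite (ipDl ip (q (_ + _))) => p0.
  have p1 := ip_ge ip_norm (h - y) (z s).
  have p2 := ip_ge ip_norm (q (z a - z s + (z b - z s))) (z s).
  have p3 : `|h - y| * `|z s| <= e * M.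
    by apply: ler_pM => //; rewrite distrC ltW.
  have p4 : `|q (z a - z s + (z b - z s))| * `|z s| <= 2 * e * M.
    apply: ler_pM => //.
    apply: le_trans (mollify_bounded ip_norm delta_gt0 B_coercive _ _) _.
    apply: (@le_trans _ _ ((delta * n%:R + 1) * (e2 + e2))).
      apply: ler_pM => //; first by rewrite lerDl.
      by apply: le_trans (ler_normD _ _) _; rewrite lerD// ltW.
    by rewrite mulrDr /e2 mulrC divfK ?gt_eqF//; lra.
  by lra.
have q1 := ((I1P Sh).2 a b _ a0 ab bT).1 zu.
have q2 := ((I2P Sh).2 a b _ a0 ab bT).2 zv.
have q3 := ((KP Sh).2 a b _ a0 ab bT).1 zz.
by rewrite /G; lra.
Qed.

Lemma paths_agree t : 0 <= t -> t <= T -> u t = v t.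
Proof.
move=> t0 tT; have [M M0 zM] := path_bounded z_cont.
apply/eqP; rewrite -subr_eq0 -normr_eq0 -sqrf_eq0 eq_le sqr_ge0 andbT -/(z t).
apply: (@le0_small _ _ ((delta^-1 + 4) * (L1 t + L2 t) + 3 * M * t + M)) => e e0.
have [n [Cn /(_ M) h]] := energy_small t0 tT e0.
have {}h : ip (J n (z t)) (z t)
    <= e * ((delta^-1 + 4) * (L1 t + L2 t) + 3 * M * t).
  by apply: h => s s0 sT; apply: zM; rewrite /= in_itv /= s0.
have -> : `|z t| ^+ 2 = ip (J n (z t)) (z t)
    + ip (iter n (damp delta B) (z t)) (z t).
  by rewrite /J ipBl subrK ip_norm.
rewrite mulrDr lerD//; apply: le_trans (ip_le ip_norm _ _) _.
apply: ler_pM => //; first by rewrite ltW// Cn.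
by apply: zM; rewrite /= in_itv /= t0.
Qed.

End pathwise.

(** * Uniqueness of the integrator *)

Lemma stieltjes_primitive_ext {R : realType} (T : R) (E E' : set R)
    (L f f' I I' : R -> R) :
  (forall s, 0 <= s -> s <= T -> (E s <-> E' s) /\ f s = f' s) ->
  (forall s, 0 <= s -> s <= T -> I s = I' s) -> 0 <= T ->
  stieltjes_primitive T E L f I -> stieltjes_primitive T E' L f' I'.
Proof.
move=> EE fE T0 [I0 IP]; split; first by rewrite -fE.
move=> a b c a0 ab bT; have [h1 h2] := IP a b c a0 ab bT.
have b0 := le_trans a0 ab; have aT := le_trans ab bT.
rewrite -!fE//; split=> h; [apply: h1|apply: h2] => s sab Es;
  (have [||Ess ->] := EE s; [by case/andP: sab; lra|by case/andP: sab; lra|]);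
  by apply: h => //; exact/Ess.
Qed.

Lemma stieltjes_primitive0 {R : realType} (T : R) (E : set R) (L f I : R -> R) :
  (forall s, 0 <= s -> s <= T -> f s = 0) -> stieltjes_primitive T E L f I ->
  forall t, 0 <= t -> t <= T -> I t = 0.
Proof.
move=> f0 [I0 IP] t t0 tT; have [h1 h2] := IP 0 t 0 (lexx _) t0 tT.
rewrite !mul0r I0 subr0 in h1 h2.
apply/eqP; rewrite eq_le h1 ?h2// => s /andP[s0 st] _; rewrite f0//; lra.
Qed.


Section integrator.
Context {R : realType} {H : completeNormedModType R}.
Variable ip : {dot H for idfun}.
Hypothesis ip_norm : hilbert_norm ip.
Variables (T : R) (E : set R) (n psi : R -> H) (S : set H).
Hypothesis S_dense : dense S.
Hypothesis n_le1 : forall s, `|n s| <= 1.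
Hypothesis psi_cont : {within `[0, T], continuous psi}.
Hypothesis psi_n : forall s, 0 <= s -> s <= T -> E s -> ip (psi s) (n s) = 1.

(** On a short interval starting at [a], a vector [l] of [S] close to [psi a]
    satisfies [<l, n s> = 1] up to [2 e] on [E], so the common integral of
    [<l, n>] measures the increments of [L1] and of [L2] up to this factor. *)
Lemma integrator_le (L1 L2 : R -> R) : L1 0 = 0 -> L2 0 = 0 ->
  (forall a b, 0 <= a -> a <= b -> b <= T -> L1 a <= L1 b) ->
  (forall a b, 0 <= a -> a <= b -> b <= T -> L2 a <= L2 b) ->
  (forall l, S l -> exists I,
     stieltjes_primitive T E L1 (fun s => ip l (n s)) I /\
     stieltjes_primitive T E L2 (fun s => ip l (n s)) I) ->
  forall t, 0 <= t -> t <= T -> L1 t <= L2 t.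
Proof.
move=> L10 L20 L1_nd L2_nd LI t t0 tT; rewrite -subr_le0.
apply: (@le0_small _ _ (2 * (L1 t + L2 t))) => e e0.
have [d d0 dpsi] := path_unif_continuous psi_cont e0.
have : (1 - 2 * e) * L1 t - (1 - 2 * e) * L1 0
    <= (1 + 2 * e) * L2 t - (1 + 2 * e) * L2 0; last first.
  by rewrite L10 L20 !mulr0 !subr0; lra.
apply: (le_of_local_increments (F := fun t => (1 - 2 * e) * L1 t)
  (G := fun t => (1 + 2 * e) * L2 t) d0 _ t0 tT) => a b a0 ab bT bad.
have [l Sl al] := approx S_dense (psi a) e0.
have ln s : a <= s <= b -> E s -> 1 - 2 * e <= ip l (n s) <= 1 + 2 * e.
  move=> /andP[sa sb] Es.
  have as_ : `|psi s - psi a| < e.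
    apply: dpsi; rewrite ?(in_itv, inE) /= ?in_itv /=; try lra.
    by rewrite ltr_norml; apply/andP; split; lra.
  have -> : l = psi s - ((psi s - psi a) + (psi a - l)).
    by rewrite addrA subrK opprB addrC subrK.
  rewrite ipBl psi_n//; try lra.
  set p := psi s - psi a + _.
  have p2 : `|p| * `|n s| <= 2 * e.
    have : `|p| <= 2 * e by apply: le_trans (ler_normD _ _) _; lra.
    by apply: le_trans; rewrite ler_piMr.
  have := ip_le ip_norm p (n s); have := ip_ge ip_norm p (n s).
  by move=> *; apply/andP; split; lra.
have [I [[_ I1] [_ I2]]] := LI l Sl.
have h1 := (I1 a b (1 - 2 * e) a0 ab bT).1 (fun s sab Es => (andP (ln s sab Es)).1).
have h2 := (I2 a b (1 + 2 * e) a0 ab bT).2 (fun s sab Es => (andP (ln s sab Es)).2).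
by lra.
Qed.

Lemma integrator_unique (L1 L2 : R -> R) : L1 0 = 0 -> L2 0 = 0 ->
  (forall a b, 0 <= a -> a <= b -> b <= T -> L1 a <= L1 b) ->
  (forall a b, 0 <= a -> a <= b -> b <= T -> L2 a <= L2 b) ->
  (forall l, S l -> exists I,
     stieltjes_primitive T E L1 (fun s => ip l (n s)) I /\
     stieltjes_primitive T E L2 (fun s => ip l (n s)) I) ->
  forall t, 0 <= t -> t <= T -> L1 t = L2 t.
Proof.
move=> L10 L20 L1_nd L2_nd LI t t0 tT; apply/eqP; rewrite eq_le.
rewrite !integrator_le// => l Sl.
by have [I [I1 I2]] := LI l Sl; exists I.
Qed.

End integrator.

(** * Geometry of a smooth convex level set *)

Section geometry.
Context {R : realType} {H : completeNormedModType R}.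
Variable ip : {dot H for idfun}.
Hypothesis ip_norm : hilbert_norm ip.
Variables (g : H -> R) (G : H -> H).
Hypothesis G_gradient : gradient ip g G.

Lemma gradient_expansion x e : 0 < e ->
  \forall h \near (0 : H), `|g (x + h) - g x - ip (G x) h| <= e * `|h|.
Proof.
move=> e0; have [/diff_locallyP[_ dg] dE] := G_gradient x.
have /eqaddoP/(_ e e0) := dg.
apply: filterS => h /=.
by rewrite !fctE /= dE opprD addrA (addrC h x).
Qed.

Lemma ray_to0 (h : H) : (t *: h : H) @[t --> (0:R)^'+] --> (0 : H).
Proof.
rewrite -[X in _ --> X](scale0r h); apply: cvgZr_tmp.
by apply: cvg_within_filter; exact: cvg_id.
Qed.

Lemma convex_above_tangent : convex_function [set: H] g ->
  forall x y, g x + ip (G x) (y - x) <= g y.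
Proof.
move=> gc x y; rewrite -subr_le0.
apply: (@le0_small _ _ `|y - x|) => e e0.
have : \forall t \near (0 : R)^'+,
    `|g (x + t *: (y - x)) - g x - ip (G x) (t *: (y - x))|
      <= e * `|t *: (y - x)|.
  exact: ray_to0 (gradient_expansion x e0).
move=> ne; near (0 : R)^'+ => t.
have t0 : 0 < t by near: t; exact: nbhs_right_gt.
have t1 : t <= 1 by near: t; exact: nbhs_right_le.
have tn : `|g (x + t *: (y - x)) - g x - ip (G x) (t *: (y - x))|
    <= e * `|t *: (y - x)| by near: t.
move: tn; rewrite ipZr normrZ gtr0_norm// ler_norml => /andP[+ _].
have : g (x + t *: (y - x)) <= t * g y + (1 - t) * g x.
  have := gc (Itv01 (ltW t0) t1) y x (in_setT _) (in_setT _).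
  rewrite /conv /= /conv /= /unstable.onem.
  have -> // : t *: y + (1 - t) *: x = x + t *: (y - x).
  by rewrite scalerBr scalerBl scale1r addrCA.
move=> h1 h2.
rewrite -(ler_pM2l t0) [leRHS]mulrCA.
by move: (e * (t * `|y - x|)) h2 => c h2; lra.
Unshelve. all: by end_near. Qed.

(** The tangent inequality between [x] and the origin. *)
Lemma gradient_lower_bound x M : convex_function [set: H] g ->
  g 0 = 0 -> 1 <= g x -> `|x| <= M -> 1 <= `|G x| * M.
Proof.
move=> gc g0 gx xM; have := convex_above_tangent gc x 0.
rewrite sub0r g0 ipNr => h.
have h2 := ip_le ip_norm (G x) x.
have h3 : `|G x| * `|x| <= `|G x| * M by rewrite ler_wpM2l.
by lra.
Qed.

Lemma normal_vector_le1 x : `|normal_vector G x| <= 1.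
Proof.
rewrite /normal_vector normrZ normfV normr_id.
by have [->|Gx] := eqVneq (G x) 0; rewrite ?normr0 ?mulr0// mulVf// normr_eq0.
Qed.

Lemma normal_vector_exterior x y : convex_function [set: H] g ->
  g y <= g x -> 0 <= ip (normal_vector G x) (x - y).
Proof.
move=> gc gyx; rewrite /normal_vector ipZl mulr_ge0 ?invr_ge0//.
have := convex_above_tangent gc x y.
by rewrite !ipBr; lra.
Qed.

Variable Df : H -> seq H -> R.
Hypothesis DfP : frechet_derivatives g Df.

Lemma frechet1_scale x a h : Df x [:: a *: h] = a * Df x [:: h].
Proof.
have [_ lin _ _] := DfP.
have D0 : Df x [:: 0] = 0.
  by have := lin x [::] [::] 1 0 0; rewrite /= scaler0 addr0 mul1r; lra.
by have := lin x [::] [::] a h 0; rewrite /= addr0 D0 addr0.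
Qed.

(** Both sides are first order expansions of [g] at [x]. *)
Lemma gradient_frechet x h : ip (G x) h = Df x [:: h].
Proof.
have [D0 _ _ Dexp] := DfP.
apply/eqP; rewrite -subr_eq0 -normr_eq0 eq_le normr_ge0 andbT.
apply: (@le0_small _ _ (2 * `|h|)) => e e0.
have n1 : \forall t \near (0 : R)^'+,
    `|g (x + t *: h) - g x - ip (G x) (t *: h)| <= e * `|t *: h|.
  exact: ray_to0 (gradient_expansion x e0).
have n2 : \forall t \near (0 : R)^'+, forall v, size v = 0%N ->
    `|Df (x + t *: h) v - Df x v - Df x (t *: h :: v)|
      <= e * `|t *: h| * \prod_(y <- v) `|y|.
  exact: ray_to0 (Dexp x 0%N e e0).
near (0 : R)^'+ => t.
have t0 : 0 < t by near: t; exact: nbhs_right_gt.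
have h1 : `|g (x + t *: h) - g x - ip (G x) (t *: h)| <= e * `|t *: h|.
  by near: t.
have : forall v, size v = 0%N ->
    `|Df (x + t *: h) v - Df x v - Df x (t *: h :: v)|
      <= e * `|t *: h| * \prod_(y <- v) `|y| by near: t.
move=> /(_ [::] erefl); rewrite big_nil mulr1 !D0 frechet1_scale => h2.
rewrite ipZr in h1.
have tE r : t * `|r| = `|t * r| by rewrite normrM gtr0_norm.
rewrite -(ler_pM2l t0) tE.
set c := g (x + t *: h) - g x in h1 h2.
have -> : t * (ip (G x) h - Df x [:: h])
    = (c - t * Df x [:: h]) - (c - t * ip (G x) h) by ring.
apply: le_trans (ler_normB _ _) _.
move: h1 h2; rewrite normrZ gtr0_norm//.
by lra.
Unshelve. all: by end_near. Qed.

(** The second derivative being a bounded bilinear form, the expansion of the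
    first derivative shows that the gradient is Lipschitz at each point. *)
Lemma gradient_continuous : continuous G.
Proof.
have [_ _ Dbd Dexp] := DfP.
move=> x; have [M xM] := Dbd x 2%N.
have yx : y - x @[y --> x] --> (0 : H).
  by rewrite -(subrr x); apply: cvgB; [exact: cvg_id|exact: cvg_cst].
have M1 : 0 < `|M| + 1 by rewrite ltr_wpDl.
apply/cvgrPdist_le => e e0.
have n1 : \forall y \near x, forall v, size v = 1%N ->
    `|Df (x + (y - x)) v - Df x v - Df x (y - x :: v)|
      <= 1 * `|y - x| * \prod_(z <- v) `|z|.
  exact: yx (Dexp x 1%N 1 ltr01).
near=> y.
have xy : `|x - y| <= e / (`|M| + 1).
  by near: y; apply: cvgr_dist_le; [exact: cvg_id|exact: divr_gt0].
have : forall v, size v = 1%N ->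
    `|Df (x + (y - x)) v - Df x v - Df x (y - x :: v)|
      <= 1 * `|y - x| * \prod_(z <- v) `|z| by near: y.
rewrite (distrC (G x)); set w := G y - G x => /(_ [:: w] erefl).
have := xM [:: y - x; w] erefl.
rewrite !big_cons !big_nil !mulr1 mul1r [x + _]addrC subrK.
rewrite -!gradient_frechet => h2 h1.
have ww : `|w| ^+ 2 = ip (G y) w - ip (G x) w by rewrite -ipBl -/w ip_norm.
have h3 : M * (`|y - x| * `|w|) <= `|M| * (`|y - x| * `|w|).
  by rewrite ler_wpM2r ?mulr_ge0// ler_norm.
have : `|w| ^+ 2 <= (`|M| + 1) * `|y - x| * `|w|.
  move: h1 h2; rewrite -ww => h1 h2.
  have := ler_norm (`|w| ^+ 2 - Df x [:: y - x; w]).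
  have := ler_norm (Df x [:: y - x; w]).
  by lra.
have [->|w0] := eqVneq w 0; first by rewrite normr0 => _; exact: ltW.
rewrite expr2 ler_pM2r ?normr_gt0// => /le_trans; apply.
by rewrite distrC -ler_pdivlMl// mulrC.
Unshelve. all: by end_near. Qed.

(** The unit normal is singular where the gradient vanishes; replacing [|G x|] by
    [max(|G x|, a)] gives a continuous field, unchanged where [a <= |G x|]. *)
Lemma clipped_normal_continuous (a : R) : continuous G -> 0 < a ->
  continuous (fun x => (Num.max `|G x| a)^-1 *: G x).
Proof.
move=> Gc a0 x; apply: cvgZ; last exact: Gc.
apply: cvgV; first by rewrite gt_eqF// lt_max a0 orbT.
apply: (@continuous_max R H (fun x => `|G x|) (cst a) x); last exact: cvg_cst.
by apply: cvg_norm; exact: Gc.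
Qed.

Lemma clipped_normal_normal (a : R) x : 0 < a -> a <= `|G x| ->
  ip ((Num.max `|G x| a)^-1 *: G x) (normal_vector G x) = 1.
Proof.
move=> a0 aG; have G0 : 0 < `|G x| := lt_le_trans a0 aG.
rewrite max_l// /normal_vector ipZl ipZr ip_norm expr2.
by rewrite mulKf ?gt_eqF// mulVf// gt_eqF.
Qed.

End geometry.

(** * Lebesgue and Stieltjes integrals as primitives *)

Section integrals.
Context {R : realType}.
Implicit Types (L f : R -> R) (T : R).

(** Integrals over [[0, a]] and [[0, b]] differ by the integral over (a, b], in
    which the null set off [E] may be discarded. The condition on [[set 0]]
    accounts for the left end point, which the half-open intervals miss. *)
Lemma stieltjes_primitive_integral
    (mu : {measure set (measurableTypeR R) -> \bar R}) T (E : set R) L f M :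
  0 <= T ->
  mu [set 0] = 0 ->
  (forall a b : R, 0 <= a -> a <= b -> b <= T ->
    mu `]a, b]%classic = (L b - L a)%:E) ->
  measurable_fun `[0, T]%classic f ->
  (forall s, 0 <= s -> s <= T -> `|f s| <= M) ->
  measurable (`[0, T] `\` E) -> mu (`[0, T] `\` E) = 0 ->
  stieltjes_primitive T E L f (fun t => \int[mu]_(s in `[0, t]) f s).
Proof.
move=> T0 mu0 muI mf fM mN muN; set N := `[0, T] `\` E in mN muN.
have split_at (a b : R) : 0 <= a -> a <= b ->
    `[0, b]%classic = `[0, a]%classic `|` `]a, b]%classic.
  move=> a0 ab.
  by rewrite -(@itv_bndbnd_setU _ R (BLeft 0) (BRight a) (BRight b)) ?bnd_simp.
have muT : (mu `[0%R, T]%classic < +oo)%E.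
  rewrite (split_at 0 T)// set_itv1.
  apply: le_lt_trans (measureU2 _ _ _) _ => //.
  change (mu [set 0%R] + mu `]0%R, T]%classic < +oo)%E.
  by rewrite mu0 add0e muI// ltry.
have int (h : R -> R) (K : R) (D : set R) :
    measurable_fun D h -> (forall s, D s -> `|h s| <= K) ->
    measurable D -> D `<=` `[0, T]%classic -> mu.-integrable D (EFin \o h).
  move=> mh hK mD DT; apply: measurable_bounded_integrable => //.
    by apply: le_lt_trans muT; apply: le_measure => //; rewrite inE.
  exists K; split; first exact: num_real.
  by move=> r Kr s Ds; apply: le_trans (hK s Ds) (ltW Kr).
have intf (D : set R) : measurable D -> D `<=` `[0, T]%classic ->
    mu.-integrable D (EFin \o f).
  move=> mD DT; apply: (int f M) => //; first exact: measurable_funS mf.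
  by move=> s /DT; rewrite /= in_itv /= => /andP[]; exact: fM.
have subset_itv (a b : R) : 0 <= a -> b <= T ->
    `]a, b]%classic `<=` `[0, T]%classic.
  by move=> a0 bT s /=; rewrite !in_itv /= => /andP[? ?]; apply/andP; split; lra.
have subset_itv0 (b : R) : b <= T -> `[0, b]%classic `<=` `[0, T]%classic.
  by move=> bT s /=; rewrite !in_itv /= => /andP[? ?]; apply/andP; split; lra.
split=> [|a b c a0 ab bT].
  rewrite set_itv1 /Rintegral null_set_integral//.
  by apply/measurable_EFinP; exact: measurable_fun_set1.
have b0 := le_trans a0 ab.
rewrite (split_at a b)// Rintegral_setU//; last 2 first.
- by rewrite -(split_at a b)//; apply: intf => //; exact: subset_itv0.
- apply/disj_setPLR => s /=; rewrite !in_itv /= => /andP[_ sa].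
  by move=> /andP[/lt_le_trans/(_ sa)]; rewrite ltxx.
rewrite (addrAC (\int[mu]_(s in _) _ s)) subrr add0r.
have mI : measurable (`]a, b]%classic : set R) by [].
have iI : mu.-integrable `]a, b]%classic (EFin \o f).
  by apply: intf => //; exact: subset_itv.
have drop (h : R -> R) : mu.-integrable `]a, b]%classic (EFin \o h) ->
    \int[mu]_(s in `]a, b]) h s = \int[mu]_(s in `]a, b] `\` N) h s.
  move=> ih; rewrite /Rintegral.
  by rewrite (@negligible_integral _ (measurableTypeR R) _ mu _ N).
have iD (h : R -> R) : mu.-integrable `]a, b]%classic (EFin \o h) ->
    mu.-integrable (`]a, b] `\` N) (EFin \o h).
  by apply: integrableS => //; exact: measurableD.
have ic : mu.-integrable `]a, b]%classic (EFin \o cst c).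
  by apply: (int _ `|c|) => //; exact: subset_itv.
have muc : \int[mu]_(s in `]a, b]) cst c s = c * (L b - L a).
  by rewrite Rintegral_cst// muI.
have inE (s : R) : (`]a, b] `\` N) s -> a <= s <= b /\ E s.
  move=> [/= sab sN]; have sT := subset_itv a b a0 bT s sab.
  move: sab; rewrite in_itv /= => /andP[/ltW -> ->]; split => //.
  by apply: contrapT => sE; exact: sN.
split=> cf; rewrite -muc (drop f)// (drop (cst c))//; apply: le_Rintegral => //;
  try exact: measurableD; try exact: iD.
  by move=> s /inE[sab Es]; exact: cf.
by move=> s /inE[sab Es]; exact: cf.
Qed.

Lemma clamp_itv T t : 0 <= T -> 0 <= clamp T t /\ clamp T t <= T.
Proof. by move=> T0; rewrite /clamp le_max lexx ge_max T0 ge_min lexx orbT. Qed.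

Lemma clamp_id T t : 0 <= t -> t <= T -> clamp T t = t.
Proof. by move=> t0 tT; rewrite /clamp min_l// max_r. Qed.

Lemma clamp_continuous T : continuous (clamp T).
Proof.
move=> t; apply: (@continuous_max R R (cst 0) (fun t => Num.min t T) t).
  exact: cvg_cst.
by apply: (@continuous_min R R id (cst T) t); [exact: cvg_id|exact: cvg_cst].
Qed.

Section stieltjes.
Variables (T : R) (L : R -> R).
Hypothesis T_ge0 : 0 <= T.
Hypothesis L_cont : {within `[0, T], continuous L}.
Hypothesis L_nd : forall a b, 0 <= a -> a <= b -> b <= T -> L a <= L b.

Lemma cumulative_ofE : (cumulative_of T L : R -> R) = L \o clamp T.
Proof.
rewrite /cumulative_of; case: pselect => [e|[]]; first exact: (projT2 (cid e)).
have nd : nondecreasing (L \o clamp T).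
  move=> a b ab /=; have [a0 _] := clamp_itv a T_ge0.
  have [_ bT] := clamp_itv b T_ge0; apply: L_nd => //.
  by rewrite /clamp; apply: le_max2 => //; exact: le_min2.
have rc : right_continuous (L \o clamp T).
  apply: right_continuousW => t.
  have [c0 cT] := clamp_itv t T_ge0.
  have cI : `[0, T]%classic (clamp T t) by rewrite /= in_itv /= c0.
  have /subspace_continuousP/(_ _ cI) := L_cont.
  move=> /cvgrPdist_lt Lc; apply/cvgrPdist_lt => e e0.
  have : \forall s \near t, `[0, T]%classic (clamp T s) ->
      `|L (clamp T t) - L (clamp T s)| < e.
    exact: (@clamp_continuous T t _ (Lc e e0)).
  apply: filterS => s; apply.
  by have [? ?] := clamp_itv s T_ge0; rewrite /= in_itv /=; apply/andP.
pose F := HB.pack_for (cumulative R R) (L \o clamp T)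
  (isCumulative.Build R _ R (L \o clamp T) nd rc).
by exists F.
Qed.

Lemma dmeas_itv a b : a <= b ->
  dmeas T L `]a, b]%classic = (L (clamp T b) - L (clamp T a))%:E.
Proof.
move=> ab; rewrite /dmeas /lebesgue_stieltjes_measure /measure_extension /=.
rewrite measurable_mu_extE /=; last exact: is_ocitv.
by rewrite wlength_itv_bnd// cumulative_ofE.
Qed.

Lemma dmeas_start : dmeas T L [set 0] = 0.
Proof.
apply/eqP; rewrite eq_le measure_ge0 andbT.
have -> : 0%E = dmeas T L `](-1)%R, 0%R]%classic.
  rewrite dmeas_itv ?lerN10// (clamp_id (lexx _) T_ge0).
  by rewrite /clamp min_l ?max_l ?subrr ?lerN10// (le_trans _ T_ge0) ?lerN10.
by apply: le_measure; rewrite ?inE// => s /= ->; rewrite in_itv /= lexx ltrN10.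
Qed.

End stieltjes.

End integrals.

(** * Pathwise solutions and the main theorem *)

Lemma within_comp {R : realType} {V W : topologicalType} (D : set R)
    (X : R -> V) (phi : V -> W) :
  {within D, continuous X} -> continuous phi ->
  {within D, continuous (phi \o X)}.
Proof.
move=> Xc phic; apply/subspace_continuousP => s Ds.
have /subspace_continuousP/(_ s Ds) Xs := Xc.
exact: cvg_comp Xs (phic (X s)).
Qed.

(** A countable set of indices is numbered by an injection into [nat], and each
    number concerns at most one index. *)
Lemma ae_countable {d : measure_display} {Omega : measurableType d}
    {R : realType} (P : probability Omega R) (I : Type) (S : set I)
    (Q : I -> Omega -> Prop) :
  countable S -> (forall i, S i -> {ae P, forall w, Q i w}) ->
  {ae P, forall w, forall i, S i -> Q i w}.
Proof.
move=> /countable_injP[f f_inj] QS.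
have : {ae P, forall w, forall n i, S i -> f i = n -> Q i w}.
  apply: ae_foralln => n.
  have [[i [Si fi]]|none] := pselect (exists i, S i /\ f i = n); last first.
    by apply: aeW => w i Si fi; exfalso; apply: none; exists i.
  apply: filterS (QS i Si) => w Qw j Sj fj.
  by have -> : j = i by apply: f_inj; rewrite ?inE// fj.
by apply: filterS => w Qw i Si; exact: Qw.
Qed.

Section deterministic.
Context {R : realType} {H : completeNormedModType R}.
Variable ip : {dot H for idfun}.
Hypothesis ip_norm : hilbert_norm ip.
Variables (Gamma : set H) (g : H -> R) (G : H -> H).
Hypothesis G_gradient : gradient ip g G.
Hypothesis G_cont : continuous G.
Hypothesis g_convex : convex_function [set: H] g.
Hypothesis g0 : g 0 = 0.
Hypothesis GammaE : Gamma = [set x | g x <= 1].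
Hypothesis boundaryE : boundary Gamma = [set x | g x = 1].
Variable B : {linear H -> H}.
Variable S : set H.
Hypothesis S_dense : dense S.
Variable T : R.
Hypothesis T_ge0 : 0 <= T.

(** A trajectory of a solution, with the noise [w] frozen: the equation is kept for
    the test vectors [B h] with [h] in [S] only, for which [A (B h) = h]. *)
Definition solution_path (w : H -> R -> R) (x : H) (X : R -> H) (L : R -> R) :=
  [/\ {within `[0, T], continuous X} /\ {within `[0, T], continuous L},
      forall t, t \in `[0, T] -> Gamma (X t),
      [/\ L 0 = 0,
          {in `[0, T] &, {homo L : s t / s <= t}} &
          forall D : set R, measurable D -> D `<=` `[0, T] ->
            (\int[dmeas T L]_(s in D) (\1_(boundary Gamma) (X s))%:E
             = dmeas T L D)%E ] &
      forall h, S h -> forall t, t \in `[0, T] ->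
        ip (B h) (X t - x) = w (B h) t
          - \int[dmeas T L]_(s in `[0, t]) ip (B h) (normal_vector G (X s))
          - \int[lebesgue_measure]_(s in `[0, t]) ip h (X s)].

Section one_path.
Variables (w : H -> R -> R) (x : H) (X : R -> H) (L : R -> R).
Hypothesis XL : solution_path w x X L.

Lemma solution_path_nd (a b : R) : 0 <= a -> a <= b -> b <= T -> L a <= L b.
Proof.
move=> a0 ab bT; have [_ _ [_ nd _] _] := XL.
by apply: nd => //; rewrite in_itv /=; apply/andP; split => //; lra.
Qed.

(** The normal field is discontinuous where the gradient vanishes, but the inverse
    is measurable, being the power of exponent -1. *)
Lemma measurable_normal_path l :
  measurable_fun `[0, T]%classic (fun s => ip l (normal_vector G (X s))).
Proof.
have [[Xc _] _ _ _] := XL.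
have -> : (fun s => ip l (normal_vector G (X s)))
    = (fun s => `|G (X s)| `^ (-1) * ip l (G (X s))).
  by apply/funext => s; rewrite /normal_vector ipZr powR_inv1.
apply: measurable_funM.
  apply: (measurableT_comp (measurable_powR _)).
  apply: subspace_continuous_measurable_fun => //.
  apply: (within_comp (phi := fun x => `|G x|)) Xc _.
  by move=> y; apply: cvg_norm; exact: G_cont.
apply: subspace_continuous_measurable_fun => //.
apply: (within_comp (phi := fun x => ip l (G x))) Xc _.
by move=> y; apply: continuous_comp; [exact: G_cont|exact: ip_continuous].
Qed.

Lemma g_continuous : continuous g.
Proof. by move=> y; apply: differentiable_continuous; have [] := G_gradient y. Qed.

(** The carrier condition, applied to the set of times off the boundary. *)
Lemma off_boundary_null : let N := `[0, T] `\` [set s | boundary Gamma (X s)] in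
  measurable N /\ dmeas T L N = 0.
Proof.
have [[Xc _] _ [_ _ carried] _] := XL.
move=> N; have mN : measurable N.
  have -> : N = `[0, T] `&` (g \o X) @^-1` (~` [set 1]).
    by rewrite /N boundaryE.
  have mg : measurable_fun `[0, T]%classic (g \o X).
    apply: subspace_continuous_measurable_fun => //.
    exact: within_comp Xc g_continuous.
  by apply: mg => //; exact: measurableC.
split => //; rewrite -carried//; last by move=> s [].
apply: integral0_eq => s [_ Ns]; rewrite indicE memNset//.
Qed.

Lemma reflection_primitive l :
  stieltjes_primitive T [set s | boundary Gamma (X s)] L
    (fun s => ip l (normal_vector G (X s)))
    (fun t => \int[dmeas T L]_(s in `[0, t]) ip l (normal_vector G (X s))).
Proof.
have [[Xc Lc] _ _ _] := XL; have [mN N0] := off_boundary_null.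
apply: (@stieltjes_primitive_integral _
  (lebesgue_stieltjes_measure (cumulative_of T L)) T _ L
  (fun s => ip l (normal_vector G (X s))) `|l|) => //.
- exact: dmeas_start T_ge0 Lc solution_path_nd.
- move=> a b a0 ab bT.
  have := dmeas_itv T_ge0 Lc solution_path_nd ab.
  by rewrite !clamp_id ?(le_trans a0 ab) ?(le_trans ab bT).
- exact: measurable_normal_path.
- move=> s _ _; apply: le_trans (cauchy_schwarz ip_norm _ _) _.
  by rewrite ler_piMr// normal_vector_le1.
Qed.

End one_path.

Lemma drift_primitive w1 w2 x1 x2 u v L1 L2 h :
  solution_path w1 x1 u L1 -> solution_path w2 x2 v L2 ->
  stieltjes_primitive T setT id (fun s => ip h (u s - v s))
    (fun t => \int[lebesgue_measure]_(s in `[0, t]) ip h (u s)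
      - \int[lebesgue_measure]_(s in `[0, t]) ip h (v s)).
Proof.
move=> [[uc _] _ _ _] [[vc _] _ _ _].
have huc : {within `[0, T], continuous (fun s => ip h (u s))}.
  apply: (within_comp (phi := ip h)) uc _; exact: ip_continuous.
have hvc : {within `[0, T], continuous (fun s => ip h (v s))}.
  apply: (within_comp (phi := ip h)) vc _; exact: ip_continuous.
have zc : {within `[0, T], continuous (fun s => ip h (u s - v s))}.
  have uvc : {within `[0, T], continuous (fun s => u s - v s)}.
    by move=> s; apply: continuousB; [exact: uc|exact: vc].
  apply: (within_comp (phi := ip h)) uvc _; exact: ip_continuous.
have [M _ hM] := path_bounded zc.
apply: (@stieltjes_primitive_ext _ T setT setT id _ _
  (fun t => \int[lebesgue_measure]_(s in `[0, t]) ip h (u s - v s))) => //.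
  move=> t t0 tT; rewrite -RintegralB//.
  - by apply: eq_Rintegral => s _; rewrite ipBr.
  - apply: continuous_compact_integrable; first exact: segment_compact.
    apply: continuous_subspaceW huc => s /=; rewrite !in_itv /= => /andP[-> st].
    exact: le_trans tT.
  - apply: continuous_compact_integrable; first exact: segment_compact.
    apply: continuous_subspaceW hvc => s /=; rewrite !in_itv /= => /andP[-> st].
    exact: le_trans tT.
apply: (@stieltjes_primitive_integral _ lebesgue_measure T _ id _ M) => //.
- exact: lebesgue_measure_set1.
- move=> a b a0 ab bT; have := lebesgue_measure_itv `]a, b].
  by rewrite /= lte_fin; case: ltgtP ab => // -> _ ->; rewrite subrr.
- exact: subspace_continuous_measurable_fun.
- by move=> s s0 sT; apply: hM; rewrite /= in_itv /= s0.
- by rewrite setDT.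
- by rewrite setDT measure0.
Qed.

Variable delta : R.
Hypothesis delta_gt0 : 0 < delta.
Hypothesis B_sym : forall x y, ip (B x) y = ip x (B y).
Hypothesis B_coercive : forall x, delta * `|B x| ^+ 2 <= ip (B x) x.
Hypothesis B_dense : dense (range B).

(** In the difference of the two equations the noise and the initial value
    cancel. After [u = v], the integrals against [dL1] and [dL2] coincide, the
    drift being zero. *)
Lemma solution_path_unique w x u v L1 L2 :
  solution_path w x u L1 -> solution_path w x v L2 ->
  forall t, 0 <= t -> t <= T -> u t = v t /\ L1 t = L2 t.
Proof.
move=> Su Sv.
have [[uc L1c] uG [L10 _ _] ueq] := Su.
have [[vc L2c] vG [L20 _ _] veq] := Sv.
have itvP s : 0 <= s -> s <= T -> s \in `[0, T] by move=> s0 sT; rewrite in_itv /= s0.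
pose I1 h t := \int[dmeas T L1]_(s in `[0, t]) ip (B h) (normal_vector G (u s)).
pose I2 h t := \int[dmeas T L2]_(s in `[0, t]) ip (B h) (normal_vector G (v s)).
pose K h t := \int[lebesgue_measure]_(s in `[0, t]) ip h (u s)
  - \int[lebesgue_measure]_(s in `[0, t]) ip h (v s).
have cancel_noise (a b c p q : R) :
    (a - b - c) - (a - p - q) = - b + p - (c - q) by ring.
have balance h : S h -> forall t, 0 <= t -> t <= T ->
    ip (B h) (u t - v t) = - I1 h t + I2 h t - K h t.
  move=> Sh t t0 tT.
  have -> : u t - v t = (u t - x) - (v t - x) by rewrite opprB addrA subrK.
  by rewrite ipBr ueq ?veq ?itvP// cancel_noise.
have uv t : 0 <= t -> t <= T -> u t = v t.
  have normal y z : boundary Gamma y -> Gamma z ->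
      0 <= ip (normal_vector G y) (y - z).
    rewrite boundaryE GammaE /= => gy gz.
    by apply: (normal_vector_exterior G_gradient); rewrite ?gy.
  apply: (paths_agree ip_norm delta_gt0 B_sym B_coercive B_dense
    S_dense uc vc L10 L20 (normal_vector_le1 G) normal
    _ _ _ _ (I1 := I1) (I2 := I2) (K := K) _ balance).
  - by move=> s s0 sT; apply: uG; exact: itvP.
  - by move=> s s0 sT; apply: vG; exact: itvP.
  - by move=> h _; exact: reflection_primitive Su _.
  - by move=> h _; exact: reflection_primitive Sv _.
  - by move=> h _; exact: drift_primitive Su Sv.
move=> t t0 tT; split; first exact: uv.
have [M M0 uM] := path_bounded uc.
have a0 : 0 < M^-1 by rewrite invr_gt0.
apply: (@integrator_unique _ _ ip ip_norm T [set s | boundary Gamma (u s)]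
  (normal_vector G \o u) (fun s => (Num.max `|G (u s)| M^-1)^-1 *: G (u s))
  (B @` S)) t0 tT => //.
- exact: (dense_image_inverse ip_norm delta_gt0 B_coercive B_dense S_dense).
- by move=> s; exact: normal_vector_le1.
- apply: (within_comp (phi := fun y => (Num.max `|G y| M^-1)^-1 *: G y)) uc _.
  exact: clipped_normal_continuous.
- move=> s s0 sT; rewrite /= boundaryE /= => gu.
  apply: clipped_normal_normal => //; rewrite -[leLHS]mul1r ler_pdivrMr//.
  apply: (gradient_lower_bound ip_norm G_gradient) => //; first by rewrite gu.
  by apply: uM; exact: itvP.
- exact: solution_path_nd Su.
- exact: solution_path_nd Sv.
- move=> _ [h Sh <-]; exists (I1 h); split; first exact: reflection_primitive Su _.
  apply: (stieltjes_primitive_ext _ _ T_ge0 (reflection_primitive Sv (B h))).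
    by move=> s s0 sT /=; rewrite uv.
  move=> s s0 sT; have := balance h Sh s s0 sT.
  rewrite uv// subrr ip_sym ip0l.
  have K0 : K h s = 0.
    apply: (stieltjes_primitive0 _ (drift_primitive h Su Sv)) => // r r0 rT.
    by rewrite uv// subrr ip_sym ip0l.
  by rewrite K0 subr0 addrC => /eqP; rewrite eq_sym subr_eq0 => /eqP.
Qed.

End deterministic.

Lemma inverse_linear {R : realType} {H : completeNormedModType R} (D : set H)
    (A B : H -> H) :
  linear_operator D A -> inverse_operator D A B -> linear B.
Proof.
move=> [_ DA lin] [BD BA] a x y.
have [Dx Ax] := BD x; have [Dy Ay] := BD y.
by rewrite -{1}Ax -{1}Ay -lin// BA//; exact: DA.
Qed.

Lemma solution_path_ae {R : realType} {H : completeNormedModType R}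
    (ip : {dot H for idfun}) (D : set H) (A : H -> H) (B : {linear H -> H})
    (Gamma : set H) (G : H -> H) (S : set H)
    (d : measure_display) (Omega : measurableType d) (P : probability Omega R)
    (Ft : R -> set (set Omega)) (W : H -> R -> Omega -> R) (T : R) (x : H)
    (X : R -> Omega -> H) (L : R -> Omega -> R) :
  inverse_operator D A B -> countable S ->
  is_solution P ip D A Gamma (normal_vector G) Ft W T x X L ->
  {ae P, forall w, solution_path ip Gamma G B S T
    (fun l t => W l t w) x (X ^~ w) (L ^~ w)}.
Proof.
move=> [BD _] Sc [_ cont inG incr eqn].
have eqS : {ae P, forall w, forall h, S h -> forall t, t \in `[0, T] ->
    ip (B h) (X t w - x) = W (B h) t w
      - \int[dmeas T (fun t => L t w)]_(s in `[0, t])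
          ip (B h) (normal_vector G (X s w))
      - \int[lebesgue_measure]_(s in `[0, t]) ip h (X s w)}.
  apply: (ae_countable Sc) => h _; have [DBh ABh] := BD h.
  by apply: filterS (eqn (B h) DBh) => w; rewrite ABh.
apply: filterS (filterI cont (filterI inG (filterI incr eqS))).
by move=> w [? [? [? ?]]]; split.
Qed.

Theorem theorem5p11 (R : realType)
  (H : completeNormedModType R) (ip : {dot H for idfun})
  (ip_norm : hilbert_norm ip) (sepH : separable H)
  (D : set H) (A Ainv : H -> H)
  (A_lin : linear_operator D A) (A_sa : self_adjoint ip D A)
  (A_pos : exists2 delta : R, 0 < delta &
     forall x, D x -> delta * `|x| ^+ 2 <= ip (A x) x)
  (A_inv : inverse_operator D A Ainv) (Ainv_tr : trace_class ip Ainv)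
  (Q : H -> H) (Q_def : forall x, Q x = 2^-1 *: Ainv x)
  (Qhalf : H -> H) (Qhalf_def : positive_sqrt ip Q Qhalf)
  (mu : probability (borelType H) R) (mu_gauss : gaussian_measure ip mu 0 Q)
  (Gamma : set H) (g : H -> R) (Dg : H -> H)
  (Gamma_reg : regular_convex ip mu Qhalf Gamma g Dg)
  (d : measure_display) (Omega : measurableType d) (P : probability Omega R)
  (Ft : R -> set (set Omega)) (Ft_filt : filtration Ft)
  (W : H -> R -> Omega -> R) (W_wiener : cylindrical_wiener P Ft W)
  (T : R) (T_gt0 : 0 < T) (x : H)
  (u v : R -> Omega -> H) (L1 L2 : R -> Omega -> R)
  (sol_u : is_solution P ip D A Gamma (normal_vector Dg) Ft W T x u L1)
  (sol_v : is_solution P ip D A Gamma (normal_vector Dg) Ft W T x v L2) :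
  {ae P, forall w, forall t, t \in `[0, T] ->
    u t w = v t w /\ L1 t w = L2 t w}.
Proof.
have [delta delta_gt0 A_coercive] := A_pos.
have [S [S_count S_dense]] := sepH.
have [[g_convex [Df DfP]] [Dg_grad g0 _] _ [GammaE boundaryE _] _] := Gamma_reg.
pose B : {linear H -> H} := HB.pack_for {linear H -> H} Ainv
  (GRing.isLinear.Build R H H *:%R Ainv (inverse_linear A_lin A_inv)).
have [BD BA] : inverse_operator D A B by [].
have [D_dense A_adj] := A_sa.
have A_sym p q : D p -> D q -> ip (A p) q = ip p (A q).
  by move=> Dp Dq; apply: (A_adj q (A q)).2.
have B_sym p q : ip (B p) q = ip p (B q).
  have [Dp Ap] := BD p; have [Dq Aq] := BD q.
  by rewrite -{1}Aq -A_sym// Ap.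
have B_coercive p : delta * `|B p| ^+ 2 <= ip (B p) p.
  have [Dp Ap] := BD p.
  by apply: le_trans (A_coercive _ Dp) _; rewrite Ap ip_sym.
have B_dense : dense (range B).
  move=> O O0 Oo; have [p [Op Dp]] := D_dense O O0 Oo.
  by exists p; split => //; exists (A p) => //; exact: BA.
have Dg_cont := gradient_continuous ip_norm Dg_grad DfP.
have path_u := solution_path_ae A_inv S_count sol_u (B := B).
have path_v := solution_path_ae A_inv S_count sol_v (B := B).
apply: filterS (filterI path_u path_v) => w [Su Sv] t.
rewrite in_itv /= => /andP[t0 tT].
exact: (solution_path_unique ip_norm Dg_grad Dg_cont g_convex g0 GammaE
  boundaryE S_dense (ltW T_gt0) delta_gt0 B_sym B_coercive B_dense Su Sv).
Qed.
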